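(* In the setting described in the context, let $\alpha\in(0,1)$ and suppose that Conditions H1, H3, H4, H5 and H6 are satisfied with constants $c_1,C_1>0$. Let $\mathcal{C}_n=\{\mathcal{C}_n(x):x\in\mathcal{X}\}$ be the confidence band $$\mathcal{C}_n(x)=\bigl[\hat f_n(x,\hat l_n)-s_n(x,\hat l_n),\ \hat f_n(x,\hat l_n)+s_n(x,\hat l_n)\bigr],\qquad s_n(x,\hat l_n)=\frac{(\hat c_n(\alpha)+c_n')\,\hat\sigma_n(x,\hat l_n)}{\sqrt n},$$ and put $$\bar\epsilon_{n,f}=\epsilon_{1n}+\epsilon_{2n}+\epsilon_{3n}\bigl(c_{n,f}(\alpha)+u_n\sqrt{\log n}\bigr),\qquad \delta_n=\delta_{1n}+\delta_{2n}+\delta_{3n}+\delta_{4n}+\delta_{5n}.$$ Then: (1) For every $f\in\mathcal{F}$, $$\mathrm{P}_f(f\in\mathcal{C}_n)\ge(1-\alpha)-\delta_n-\tau_n-p_{\bar\epsilon_{n,f}}(|G_{n,f}|).$$ (2) If, in addition, Condition H2(a) is satisfied and $\epsilon_{3n}u_n\sqrt{\log n}\le C_1n^{-c_1}$, then $$\liminf_{n\to\infty}\inf_{f\in\mathcal{F}}\mathrm{P}_f(f\in\mathcal{C}_n)\ge 1-\alpha.$$ (3) If, in addition to the assumptions of (2), Condition H2(b) is satisfied, then $$\inf_{f\in\mathcal{F}}\mathrm{P}_f(f\in\mathcal{C}_n)\ge 1-\alpha-Cn^{-c},$$ where $c,C>0$ are constants depending only on $\alpha$, $c_1$ and $C_1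$.
   Context: Setting. $X_1,\dots,X_n$ are i.i.d. random vectors with unknown density $f\in\mathcal{F}$, where $\mathcal{F}$ is a nonempty set of densities on $\mathbb{R}^d$; $\mathrm{P}_f,\mathrm{E}_f$ denote probability and expectation under $f$. All sequences are indexed by the sample size $n\ge 2$. $\mathcal{X}\subset\mathbb{R}^d$ is a set of interest and $\mathcal{L}_n$ is a candidate set of smoothing parameters; $\mathcal{V}_n=\mathcal{X}\times\mathcal{L}_n$. For $l\in\mathcal{L}_n$, $\hat f_n(\cdot,l)$ is a generic estimator of $f$; $\sigma_{n,f}(x,l)$ is the standard deviation of $\sqrt n\hat f_n(x,l)$ under $f$, assumed positive on $\mathcal{V}_n$ for all $f\in\mathcal{F}$. $\hat l_n=\hat l_n(X_1,\dots,X_n)\in\mathcal{L}_n$ is a possibly data-dependent choice. Write $\|z\|_{T}=\sup_{t\in T}|z(t)|$. Let $$Z_{n,f}(x,l)=\frac{\sqrt n(\hat f_n(x,l)-\mathrm{E}_f[\hat f_n(x,l)])}{\sigma_{n,f}(x,l)},\qquad W_{n,f}=\|Z_{n,f}\|_{\mathcal{V}_n},\qquad \Delta_{n,f}(l)=\sup_{x\in\mathcal{X}}\frac{\sqrt n\,|f(x)-\mathrm{E}_f[\hat f_n(x,l)]|}{\sigma_{n,f}(x,l)};$$ $W_{n,f}$ is assumed to be a well-defined random variable. $\hat\sigma_n(x,l)\ge0$ is a generic estimator of $\sigma_{n,f}(x,l)$; $\hat c_n(\alpha)\ge 0$ is a generic (data-dependent) estimator of $c_{n,f}(\alpha)$ defined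 below; $c_n'$ is a sequence of random variables. $f\in\mathcal{C}_n$ means $f(x)\in\mathcal{C}_n(x)$ for all $x\in\mathcal{X}$. For a separable process $Y=(Y_t)_{t\in T}$ and $\epsilon\ge 0$, $p_\epsilon(|Y|)=\sup_{x\in\mathbb{R}}\mathrm{P}(|\sup_{t\in T}|Y_t|-x|\le\epsilon)$. The $(1-\beta)$-quantile of a random variable $\xi$ is $\inf\{x\in\mathbb{R}:\mathrm{P}(\xi\le x)\ge1-\beta\}$ (as an extended real). With $G_{n,f}$ from Condition H1, $c_{n,f}(\beta)$ is the $(1-\beta)$-quantile of $\|G_{n,f}\|_{\mathcal{V}_n}$. Conditions ($c_1,C_1$ are positive constants independent of $n$): H1. For every $f\in\mathcal{F}$ there exists (on a possibly enriched probability space) a sequence of random variables $W^0_{n,f}$ such that (i) $W^0_{n,f}$ has the same distribution as $\|G_{n,f}\|_{\mathcal{V}_n}$, where $G_{n,f}=\{G_{n,f}(v):v\in\mathcal{V}_n\}$ is a tight Gaussian random element in $\ell^\infty(\mathcal{V}_n)$ (the bounded functions on $\mathcal{V}_n$ with the sup norm) with $\mathrm{E}[G_{n,f}(v)]=0$, $\mathrm{E}[G_{n,f}(v)^2]=1$ for all $v\in\mathcal{V}_n$, and $\mathrm{E}[\|G_{n,f}\|_{\mathcal{V}_n}]\le C_1\sqrt{\log n}$; and (ii) $\sup_{f\in\mathcal{F}}\mathrm{P}_f(|W_{n,f}-W^0_{n,f}|>\epsilon_{1n})\le\delta_{1n}$, where $\epsilon_{1n},\delta_{1n}$ are sequences of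 positive numbers bounded from above by $C_1n^{-c_1}$. H2(a). For any sequence $\epsilon_n$ of positive numbers with $\epsilon_n\sqrt{\log n}\to0$, $\sup_{f\in\mathcal{F}}p_{\epsilon_n}(|G_{n,f}|)\to0$. H2(b). For any sequence $\epsilon_n$ of positive numbers, $\sup_{f\in\mathcal{F}}p_{\epsilon_n}(|G_{n,f}|)\le C_1\epsilon_n\sqrt{\log n}$. H3. For some sequences $\tau_n,\epsilon_{2n},\delta_{2n}$ of positive numbers bounded from above by $C_1n^{-c_1}$: (a) $\sup_{f\in\mathcal{F}}\mathrm{P}_f(\hat c_n(\alpha)<c_{n,f}(\alpha+\tau_n)-\epsilon_{2n})\le\delta_{2n}$ and (b) $\sup_{f\in\mathcal{F}}\mathrm{P}_f(\hat c_n(\alpha)>c_{n,f}(\alpha-\tau_n)+\epsilon_{2n})\le\delta_{2n}$. H4. For some sequences $\epsilon_{3n},\delta_{3n}$ of positive numbers bounded from above by $C_1n^{-c_1}$, $\sup_{f\in\mathcal{F}}\mathrm{P}_f\bigl(\sup_{v\in\mathcal{V}_n}|\hat\sigma_n(v)/\sigma_{n,f}(v)-1|>\epsilon_{3n}\bigr)\le\delta_{3n}$. H5. For some sequence $\delta_{4n}$ of positive numbers bounded from above by $C_1n^{-c_1}$, $\sup_{f\in\mathcal{F}}\mathrm{P}_f(\Delta_{n,f}(\hat l_n)>c_n')\le\delta_{4n}$. H6. For some sequences $\delta_{5n},u_n$ of positive numbers, with $\delta_{5n}$ bounded from above by $C_1n^{-c_1}$, $\sup_{f\in\mathcal{F}}\mathrm{P}_f(c_n'>u_n\sqrt{\log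 n})\le\delta_{5n}$. *)

(* Defs.v *)
From HB Require Import structures.
From mathcomp Require Import all_boot all_order all_algebra.
From mathcomp Require Import all_classical all_reals all_analysis.
From mathcomp Require Import measurable_realfun.

Set Implicit Arguments.
Unset Strict Implicit.
Unset Printing Implicit Defensive.

Import Order.TTheory GRing.Theory Num.Theory.
Import numFieldNormedType.Exports.

Local Open Scope classical_set_scope.
Local Open Scope ring_scope.

(* R^d is the measurable type [d.-tuple R], whose sigma-algebra is generated by
   the coordinate projections, i.e. the Borel sigma-algebra. *)

Section lebesgue_tuple.
Context {R : realType}.
Local Open Scope ereal_scope.

Definition cons_pair d (p : R * d.-tuple R) : d.+1.-tuple R :=
  [the d.+1.-tuple R of p.1 :: p.2].

Lemma measurable_cons_pair d : measurable_fun setT (@cons_pair d).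
Proof. exact: measurable_cons. Qed.

Definition lebesgue_cons d (m : {sigma_finite_measure set (d.-tuple R) -> \bar R})
    : set (d.+1.-tuple R) -> \bar R :=
  pushforward
    ((@lebesgue_measure R : set (measurableTypeR R) -> \bar R) \x m)%E (@cons_pair d).

Section lebesgue_cons_measure.
Context d (m : {sigma_finite_measure set (d.-tuple R) -> \bar R}).

Let mc A : measurable A -> measurable (@cons_pair d @^-1` A).
Proof.
by move=> mA; rewrite -[X in measurable X]setTI; exact: measurable_cons_pair.
Qed.

Let lebesgue_cons0 : lebesgue_cons m set0 = 0.
Proof. by rewrite /lebesgue_cons /pushforward preimage_set0 measure0. Qed.

Let lebesgue_cons_ge0 A : 0 <= lebesgue_cons m A.
Proof. by rewrite /lebesgue_cons /pushforward measure_ge0. Qed.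

Let lebesgue_cons_additive : semi_sigma_additive (lebesgue_cons m).
Proof.
move=> F mF tF mUF; rewrite /lebesgue_cons /pushforward preimage_bigcup.
apply: measure_semi_sigma_additive.
- by move=> n; exact: mc.
- apply/trivIsetP => /= i j _ _ ij; rewrite -preimage_setI.
  by move/trivIsetP : tF => /(_ _ _ _ _ ij) ->//; rewrite preimage_set0.
- by rewrite -preimage_bigcup; exact: mc.
Qed.

HB.instance Definition _ := isMeasure.Build _ _ _ (lebesgue_cons m)
  lebesgue_cons0 lebesgue_cons_ge0 lebesgue_cons_additive.

Let lebesgue_cons_sigma_finite : sigma_finite setT (lebesgue_cons m).
Proof.
have /sigma_finiteP[F [TF ndF Foo]] := sigma_finiteT (@lebesgue_measure R).
have /sigma_finiteP[G [TG ndG Goo]] := sigma_finiteT m.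
pose g (t : d.+1.-tuple R) : R * d.-tuple R := (thead t, [tuple of behead t]).
have mg : measurable_fun setT g.
  apply/measurable_fun_pairP; split.
    exact: measurable_tnth.
  exact: measurable_behead.
have gK : cancel (@cons_pair d) g.
  by move=> [x t]; rewrite /g /cons_pair; congr pair; exact: val_inj.
exists (fun i => g @^-1` (F i `*` G i)).
  apply/seteqP; split=> // t _.
  have [i _ Fi] : (\bigcup_i F i) (g t).1 by rewrite -TF.
  have [j _ Gj] : (\bigcup_i G i) (g t).2 by rewrite -TG.
  exists (maxn i j) => //; split.
  - by move: (g t).1 Fi; exact/subsetPset/ndF/leq_maxl.
  - by move: (g t).2 Gj; exact/subsetPset/ndG/leq_maxr.
move=> i; have [mFi Fi] := Foo i; have [mGi Gi] := Goo i; split.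
  by rewrite -[X in measurable X]setTI; apply: mg => //; exact: measurableX.
rewrite /lebesgue_cons /pushforward -comp_preimage.
rewrite (_ : g \o _ = id); last by apply/funext => p /=; exact: gK.
by rewrite preimage_id product_measure1E// lte_mul_pinfty// ge0_fin_numE.
Qed.

HB.instance Definition _ := Measure_isSigmaFinite.Build _ _ _ (lebesgue_cons m)
  lebesgue_cons_sigma_finite.

End lebesgue_cons_measure.

Fixpoint lebesgue_tuple d : {sigma_finite_measure set (d.-tuple R) -> \bar R} :=
  match d with
  | 0 => \d_([tuple] : 0.-tuple R)
  | d'.+1 => lebesgue_cons (lebesgue_tuple d')
  end.

End lebesgue_tuple.

Section probability_notions.
Context {R : realType}.
Local Open Scope ereal_scope.

(* Suprema over uncountable index sets need not be measurable: upper bounds on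
   probabilities of such events are stated with the outer probability [mu_ext P]
   and lower bounds with the inner one. Both agree with [P] on events. *)
Definition inner_prob d (T : measurableType d) (P : probability T R)
    (A : set T) : \bar R :=
  1 - mu_ext P (~` A).

Definition supnorm I (A : set I) (z : I -> R) : \bar R :=
  ereal_sup [set `|z t|%:E | t in A].

Definition quantile d (T : measurableType d) (Q : probability T R)
    (xi : T -> \bar R) (p : R) : \bar R :=
  ereal_inf [set x%:E | x in [set x : R | p%:E <= Q [set w | xi w <= x%:E]]].

(* [normal_prob m 0] is not the degenerate normal law, hence the test. *)
Definition normal_rv d (T : measurableType d) (Q : probability T R)
    (Y : T -> R) : Prop :=
  measurable_fun setT Y /\
  exists m s : R, forall B, measurable B ->
    Q (Y @^-1` B) = if s == 0%R then \d_m B else normal_prob m s B.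

(* A process indexed by [I] together with its own probability space. *)
Record process (I : Type) := Process {
  process_display : measure_display;
  process_space : measurableType process_display;
  process_prob : probability process_space R;
  process_path :> process_space -> I -> R }.

Section process_notions.
Variables (I : choiceType) (G : process I).
Let Q := process_prob G.

(* l^oo(I) is a (clopen) subspace of [{uniform I -> R}]; its compact sets are
   the compact sets of [{uniform I -> R}] made of bounded functions. *)
Record tight_gaussian : Prop := TightGaussian {
  tg_bounded : forall w, exists M : R, forall v, (`|G w v| <= M)%R ;
  tg_borel : forall O : set {uniform I -> R}, open O ->
    measurable [set w | O (G w)] ;
  tg_tight : forall e : R, (0 < e)%R ->
    exists2 K : set {uniform I -> R}, compact K &
      (1 - e)%:E <= Q [set w | K (G w)] ;
  tg_normal : forall (k : nat) (v : 'I_k -> I) (a : 'I_k -> R),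
    normal_rv Q (fun w => \sum_(i < k) a i * G w (v i))%R }.

Definition process_norm (w : process_space G) : \bar R := supnorm setT (G w).

(* p_eps(|G|) *)
Definition concentration (eps : R) : \bar R :=
  ereal_sup [set Q [set w | `|process_norm w - x%:E| <= eps%:E] | x in @setT R].

End process_notions.

Definition density d (f : d.-tuple R -> R) : Prop :=
  [/\ measurable_fun setT f, forall x, (0 <= f x)%R &
      \int[lebesgue_tuple d]_x (f x)%:E = 1].

Definition iid_with_density d dT (T : measurableType dT) (P : probability T R)
    (X : nat -> T -> d.-tuple R) (f : d.-tuple R -> R) : Prop :=
  [/\ forall i, measurable_fun setT (X i),
      forall i (B : set (d.-tuple R)), measurable B ->
        P (X i @^-1` B) = \int[lebesgue_tuple d]_(x in B) (f x)%:E &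
      forall n (B : 'I_n -> set (d.-tuple R)), (forall i, measurable (B i)) ->
        P (\bigcap_(i in [set: 'I_n]) (X i @^-1` B i)) =
        \prod_(i < n) P (X i @^-1` B i)].

End probability_notions.
Arguments process : clear implicits.

(* The data of the problem. Estimators at sample size n are functions of the
   sample (X_1, ..., X_n), an element of [n.-tuple (d.-tuple R)]. For each n and
   f, [gauss n f] is the process G_{n,f}; only its law is used. *)
Record model (R : realType) (d : nat) := Model {
  densities : set (d.-tuple R -> R) ;
  omega_display : measure_display ;
  omega : measurableType omega_display ;
  law : (d.-tuple R -> R) -> probability omega R ;
  obs : nat -> omega -> d.-tuple R ;
  region : set (d.-tuple R) ;
  smoothing : choiceType ;
  cand : nat -> set smoothing ;
  fhat : forall n, n.-tuple (d.-tuple R) -> d.-tuple R -> smoothing -> R ;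
  lhat : forall n, n.-tuple (d.-tuple R) -> smoothing ;
  sigmahat : forall n, n.-tuple (d.-tuple R) -> d.-tuple R -> smoothing -> R ;
  chat : forall n, n.-tuple (d.-tuple R) -> R -> R ;
  cprime : nat -> omega -> R ;
  gauss : forall n, (d.-tuple R -> R) ->
    process R (set_type (region `*` cand n)) }.

Arguments law {R d} m f : rename.
Arguments obs {R d} m i w : rename.
Arguments cand {R d} m n : rename.
Arguments fhat {R d} m {n} s x l : rename.
Arguments lhat {R d} m {n} s : rename.
Arguments sigmahat {R d} m {n} s x l : rename.
Arguments chat {R d} m {n} s b : rename.
Arguments cprime {R d} m n w : rename.
Arguments gauss {R d} m n f : rename.

Section model_notions.
Context {R : realType} {d : nat} (M : model R d).
Implicit Types (n : nat) (f : d.-tuple R -> R) (x : d.-tuple R)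
  (l : smoothing M) (w : omega M) (b : R).

Definition vset n : set (d.-tuple R * smoothing M) := region M `*` cand M n.

Definition sample n w : n.-tuple (d.-tuple R) := [tuple obs M i w | i < n].

Definition rootn n : R := Num.sqrt n%:R.
Definition rootlog n : R := Num.sqrt (ln n%:R).

Definition mean_fhat n f x l : R :=
  fine ('E_(law M f)[fun w => fhat M (sample n w) x l])%E.

Definition sigma n f x l : R :=
  Num.sqrt (fine ('V_(law M f)[fun w => (rootn n * fhat M (sample n w) x l)%R])%E).

Definition Z n f w (v : d.-tuple R * smoothing M) : R :=
  rootn n * (fhat M (sample n w) v.1 v.2 - mean_fhat n f v.1 v.2) /
  sigma n f v.1 v.2.

Definition W n f w : \bar R := supnorm (vset n) (Z n f w).

Definition Delta n f l : \bar R :=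
  ereal_sup [set (rootn n * `|f x - mean_fhat n f x l| / sigma n f x l)%:E
            | x in region M].

Definition cquant n f b : \bar R :=
  quantile (process_prob (gauss M n f)) (@process_norm _ _ (gauss M n f)) (1 - b).

Definition halfwidth (alpha : R) n w x : R :=
  let s := sample n w in
  (chat M s alpha + cprime M n w) * sigmahat M s x (lhat M s) / rootn n.

Definition band (alpha : R) n w x : interval R :=
  let c := fhat M (sample n w) x (lhat M (sample n w)) in
  `[c - halfwidth alpha n w x, c + halfwidth alpha n w x].

Definition covers (alpha : R) n f : set (omega M) :=
  [set w | forall x, region M x -> f x \in band alpha n w x].

Record standing (alpha : R) : Prop := Standing {
  st_nonempty : densities M !=set0 ;
  st_density : forall f, densities M f -> density f ;
  st_iid : forall f, densities M f -> iid_with_density (law M f) (obs M) f ;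
  st_fhat_meas : forall n x l, (2 <= n)%N -> vset n (x, l) ->
    measurable_fun setT (fun s : n.-tuple (d.-tuple R) => fhat M s x l) ;
  st_fhat_L2 : forall n f x l, (2 <= n)%N -> densities M f -> vset n (x, l) ->
    (fun w => fhat M (sample n w) x l) \in Lfun (law M f) 2%:E ;
  st_sigma_gt0 : forall n f x l, (2 <= n)%N -> densities M f ->
    vset n (x, l) -> 0 < sigma n f x l ;
  st_lhat : forall n (s : n.-tuple (d.-tuple R)), (2 <= n)%N ->
    cand M n (lhat M s) ;
  st_W_meas : forall n f, (2 <= n)%N -> densities M f ->
    measurable_fun setT (W n f) ;
  st_sigmahat_meas : forall n x l, (2 <= n)%N -> vset n (x, l) ->
    measurable_fun setT (fun s : n.-tuple (d.-tuple R) => sigmahat M s x l) ;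
  st_sigmahat_ge0 : forall n (s : n.-tuple (d.-tuple R)) x l, (2 <= n)%N ->
    vset n (x, l) -> 0 <= sigmahat M s x l ;
  st_chat_meas : forall n, (2 <= n)%N ->
    measurable_fun setT (fun s : n.-tuple (d.-tuple R) => chat M s alpha) ;
  st_chat_ge0 : forall n (s : n.-tuple (d.-tuple R)), (2 <= n)%N ->
    0 <= chat M s alpha ;
  st_cprime_meas : forall n, (2 <= n)%N ->
    measurable_fun setT (cprime M n) }.

Definition poly_small (c1 C1 : R) (a : nat -> R) : Prop :=
  forall n, (2 <= n)%N -> 0 < a n <= C1 * n%:R `^ (- c1).

Definition positive (a : nat -> R) : Prop := forall n, (2 <= n)%N -> 0 < a n.

(* The enriched space (T, Q) projects onto [omega M] by [proj], and Q projects
   onto [law M f]. *)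
Definition condH1 (c1 C1 : R) (eps1 delta1 : nat -> R) : Prop :=
  [/\ poly_small c1 C1 eps1, poly_small c1 C1 delta1 &
   forall f, densities M f ->
    (forall n, (2 <= n)%N ->
      let G := gauss M n f in
      [/\ tight_gaussian G,
          forall v, ('E_(process_prob G)[fun y => G y v] = 0)%E,
          forall v, ('E_(process_prob G)[fun y => (G y v ^+ 2)%R] = 1)%E &
          (\int[process_prob G]_y process_norm y <= (C1 * rootlog n)%:E)%E]) /\
    exists (dT : measure_display) (T : measurableType dT)
      (Q : probability T R) (proj : T -> omega M) (W0 : nat -> T -> R),
      [/\ measurable_fun setT proj,
          forall A, measurable A -> Q (proj @^-1` A) = law M f A &
          forall n, (2 <= n)%N ->
            [/\ measurable_fun setT (W0 n),
                forall B : set (\bar R), measurable B ->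
                  Q [set t | B (W0 n t)%:E] =
                  process_prob (gauss M n f) [set y | B (process_norm y)] &
                (Q [set t | (eps1 n)%:E < `|W n f (proj t) - (W0 n t)%:E|]
                  <= (delta1 n)%:E)%E]]].

Definition condH2a : Prop :=
  forall eps : nat -> R, positive eps ->
    eps n * rootlog n @[n --> \oo] --> (0 : R) ->
    ereal_sup [set concentration (gauss M n f) (eps n) | f in densities M]
      @[n --> \oo] --> 0%E.

Definition condH2b (C1 : R) : Prop :=
  forall eps : nat -> R, positive eps -> forall n, (2 <= n)%N ->
    (ereal_sup [set concentration (gauss M n f) (eps n) | f in densities M]
      <= (C1 * eps n * rootlog n)%:E)%E.

Definition condH3 (alpha c1 C1 : R) (tau eps2 delta2 : nat -> R) : Prop :=
  [/\ poly_small c1 C1 tau, poly_small c1 C1 eps2, poly_small c1 C1 delta2,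
   forall n, (2 <= n)%N ->
    (ereal_sup [set law M f [set w | (chat M (sample n w) alpha)%:E <
                              cquant n f (alpha + tau n) - (eps2 n)%:E]
               | f in densities M] <= (delta2 n)%:E)%E &
   forall n, (2 <= n)%N ->
    (ereal_sup [set law M f [set w | cquant n f (alpha - tau n) + (eps2 n)%:E <
                              (chat M (sample n w) alpha)%:E]
               | f in densities M] <= (delta2 n)%:E)%E].

Definition condH4 (c1 C1 : R) (eps3 delta3 : nat -> R) : Prop :=
  [/\ poly_small c1 C1 eps3, poly_small c1 C1 delta3 &
   forall n, (2 <= n)%N ->
    (ereal_sup [set mu_ext (law M f) [set w | (eps3 n)%:E <
        supnorm (vset n)
          (fun v => sigmahat M (sample n w) v.1 v.2 / sigma n f v.1 v.2 - 1)%R]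
      | f in densities M] <= (delta3 n)%:E)%E].

Definition condH5 (c1 C1 : R) (delta4 : nat -> R) : Prop :=
  poly_small c1 C1 delta4 /\
  forall n, (2 <= n)%N ->
    (ereal_sup [set mu_ext (law M f) [set w | (cprime M n w)%:E <
        Delta n f (lhat M (sample n w))]
      | f in densities M] <= (delta4 n)%:E)%E.

Definition condH6 (c1 C1 : R) (delta5 u : nat -> R) : Prop :=
  [/\ poly_small c1 C1 delta5, positive u &
   forall n, (2 <= n)%N ->
    (ereal_sup [set law M f [set w | (u n * rootlog n < cprime M n w)%R]
               | f in densities M] <= (delta5 n)%:E)%E].

(* [cquant n f alpha] is a real number when 0 < alpha < 1. *)
Definition epsbar (alpha : R) (eps1 eps2 eps3 u : nat -> R) n f : R :=
  eps1 n + eps2 n + eps3 n * (fine (cquant n f alpha) + u n * rootlog n).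

End model_notions.
Arguments covers {R d} M alpha n f.

(* Main.v *)
Require Import Defs.
From mathcomp Require Import all_boot all_order all_algebra.
From mathcomp Require Import all_classical all_reals all_analysis.
From mathcomp Require Import measurable_realfun.
From mathcomp Require Import ring lra.

(* Put P = law M f, q = c_n(alpha + tau_n) and e = epsbar. Outside five bad
   events of total outer probability at most delta_n - delta1_n +
   P(W > q - e + eps1_n), the estimation error is at most the half-width of the
   band. By H1, P(W > q - e + eps1_n) <= delta1_n + P(||G|| > q - e), and the last
   probability is at most P(||G|| > q) + p_e(|G|) <= alpha + tau_n + p_e(|G|).
   This needs eps3_n <= 1; otherwise e >= c_n(alpha) and already
   p_e(|G|) >= 1 - alpha.
   For the asymptotic statements, Markov's inequality and H1 give
   c_n(alpha) <= C1 sqrt(log n) / alpha, so that e sqrt(log n) is of order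
   n^(-c1) log n uniformly in f. *)

Import Order.TTheory GRing.Theory Num.Theory.
Import numFieldNormedType.Exports.

Local Open Scope classical_set_scope.
Local Open Scope ring_scope.

(** * Quantiles of extended-real random variables *)

Section quantile.
Local Open Scope ereal_scope.
Context {R : realType} {d : measure_display} {T : measurableType d}.
Context (Q : probability T R) (xi : T -> \bar R).

Lemma quantile_le (p x : R) :
  p%:E <= Q [set w | xi w <= x%:E] -> quantile Q xi p <= x%:E.
Proof. by move=> px; apply: ereal_inf_lbound; exists x. Qed.

Lemma le_quantile (p q : R) : (p <= q)%R -> quantile Q xi p <= quantile Q xi q.
Proof.
move=> pq; apply: ereal_inf_le_tmp => _ [x /= qx <-]; exists x => //=.
by apply: le_trans qx; rewrite lee_fin.
Qed.

(** For [p <= 0] every real number qualifies and the quantile is [-oo]; for [p > 0] no negative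
    number does. *)
Lemma quantile_ge0 (p : R) : (forall w, 0 <= xi w) -> (0 < p)%R ->
  0 <= quantile Q xi p.
Proof.
move=> xi0 p0; apply: le_ereal_inf_tmp => _ [x /= px <-].
rewrite leNgt; apply/negP => x0; move: px.
rewrite (_ : [set w | _] = set0) ?measure0; last first.
  by rewrite -subset0 => w /= /le_lt_trans /(_ x0); rewrite ltNge xi0.
by rewrite lee_fin leNgt p0.
Qed.

Hypothesis mxi : measurable_fun setT xi.

Lemma measurable_sublevel (y : \bar R) : measurable [set w | xi w <= y].
Proof.
by rewrite -[X in measurable X]setTI; exact: emeasurable_fun_infty_c.
Qed.

Lemma measurable_superlevel (y : \bar R) : measurable [set w | y < xi w].
Proof.
by rewrite -[X in measurable X]setTI; exact: emeasurable_fun_o_infty.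
Qed.

(** Continuity from above: the sublevel sets at [q + 1/(n+1)], each of probability at least [p],
    decrease to the one at [q]. So a finite quantile is an attained infimum. *)
Lemma le_prob_quantile (p q : R) : quantile Q xi p = q%:E ->
  p%:E <= Q [set w | xi w <= q%:E].
Proof.
move=> Eq; pose F n := [set w | xi w <= (q + n.+1%:R^-1)%:E].
have capF : \bigcap_n F n = [set w | xi w <= q%:E].
  apply/seteqP; split=> w /=; last first.
    move=> wq n _; apply: le_trans wq _.
    by rewrite lee_fin lerDl invr_ge0.
  move=> Fw; apply/lee_addgt0Pr => e e0.
  pose n := Num.truncn e^-1; have := Fw n I => /le_trans; apply.
  rewrite -EFinD lee_fin lerD2l -[leRHS]invrK lef_pV2 ?posrE ?invr_gt0//.
  by apply/ltW; exact: truncnS_gt.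
have pF n : p%:E <= Q (F n).
  have : quantile Q xi p < (q + n.+1%:R^-1)%:E.
    by rewrite Eq lte_fin ltrDl invr_gt0.
  move/ereal_inf_lt => [_ [x /= px <-]] xq.
  apply: le_trans px _; apply: le_measure; rewrite ?inE; [exact: measurable_sublevel..|].
  by move=> w /= /le_trans; apply; exact: ltW.
have cF : Q \o F @ \oo --> Q (\bigcap_n F n).
  apply: nonincreasing_cvg_mu.
  - by rewrite (le_lt_trans (probability_le1 _ _)) ?ltry//; exact: measurable_sublevel.
  - by move=> n; exact: measurable_sublevel.
  - by rewrite capF; exact: measurable_sublevel.
  - move=> m n mn; apply/subsetPset => w /= /le_trans; apply.
    by rewrite lee_fin lerD2l lef_pV2 ?posrE// ler_nat.
rewrite -capF -(cvg_lim _ cF)//; apply: lime_ge.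
  by apply/cvg_ex; eexists; exact: cF.
exact: nearW.
Qed.

(** By Markov's inequality [xi] exceeds [m / b] with probability at most [b], so [m / b] qualifies
    in the infimum. *)
Lemma quantile_markov (b m : R) : (forall w, 0 <= xi w) -> (0 < b)%R -> (0 < m)%R ->
  \int[Q]_w xi w <= m%:E -> quantile Q xi (1 - b) <= (m / b)%:E.
Proof.
move=> xi0 b0 m0 Em; apply: quantile_le.
have mb0 : (0 < m / b)%R by rewrite divr_gt0.
have markov : (m / b)%:E * Q [set w | (m / b)%:E <= xi w] <= m%:E.
  apply: le_trans Em.
  have := @le_integral_comp_abse _ _ _ Q setT measurableT xi (m / b)%R id
    (@measurable_id _ _ _) (fun r h => h) (fun x y _ _ h => h) mxi mb0.
  rewrite setTI; under eq_integral do rewrite gee0_abs//.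
  by under eq_set do rewrite gee0_abs//.
have Qb : Q [set w | (m / b)%:E < xi w] <= b%:E.
  apply: (@le_trans _ _ (Q [set w | (m / b)%:E <= xi w])).
    apply: le_measure; rewrite ?inE; first exact: measurable_superlevel.
    - rewrite -[X in measurable X]setTI; exact: emeasurable_fun_c_infty.
    - by move=> w /= /ltW.
  by rewrite -(@lee_pmul2l _ (m / b)%:E)// -EFinM divfK ?gt_eqF// mulrC.
have -> : [set w | xi w <= (m / b)%:E] = ~` [set w | (m / b)%:E < xi w].
  by apply/seteqP; split=> w /=; rewrite leNgt => /negP.
rewrite probability_setC; last exact: measurable_superlevel.
by rewrite EFinB leeB.
Qed.

End quantile.

(** * Outer and inner probability *)

Section outer_probability.
Local Open Scope ereal_scope.
Context {R : realType} {d : measure_display} {T : measurableType d}.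
Context (P : probability T R).

Lemma mu_ext_le1 A : mu_ext P A <= 1.
Proof.
rewrite -(probability_setT P) -(measurable_mu_extE P (@measurableT _ T)).
exact: le_mu_ext.
Qed.

Lemma inner_prob_ge0 A : 0 <= inner_prob P A.
Proof. by rewrite /inner_prob sube_ge0 ?orbT // mu_ext_le1. Qed.

Lemma inner_prob_setT : inner_prob P setT = 1.
Proof. by rewrite /inner_prob setCT measurable_mu_extE // measure0 sube0. Qed.

Lemma mu_extU2 A B : mu_ext P (A `|` B) <= mu_ext P A + mu_ext P B.
Proof. exact: (outer_measureU2 (mu_ext P)). Qed.

End outer_probability.

(** * Sup norm of a process: measurability, tail and concentration *)

Section process_norm.
Local Open Scope ereal_scope.
Context {R : realType} {I : choiceType} (G : process R I).

Lemma lt_supnorm (z : I -> R) (A : set I) (y : \bar R) :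
  y < supnorm A z <-> exists2 v, A v & y < `|z v|%:E.
Proof.
split; first by move=> /ereal_sup_gt[_ [v Av <-] yv]; exists v.
by move=> [v Av /lt_le_trans]; apply; apply: ereal_sup_ubound; exists v.
Qed.

Lemma supnorm_ub (z : I -> R) (A : set I) v : A v -> `|z v|%:E <= supnorm A z.
Proof. by move=> Av; apply: ereal_sup_ubound; exists v. Qed.

Lemma process_norm_ge0 (v : I) (w : process_space G) : 0 <= process_norm w.
Proof. by apply: (@le_trans _ _ `|G w v|%:E); [rewrite lee_fin | exact: supnorm_ub]. Qed.

(** If [|z v|] exceeds [y], so does [|h v|] for every [h] uniformly closer to [z] than [|z v| - y].
    This brings a supremum over an uncountable index set within reach of [tg_borel]. *)
Lemma open_supnorm_gt (y : R) :
  open [set z : {uniform I -> R} | y%:E < supnorm setT z].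
Proof.
rewrite openE => z /lt_supnorm[v _ yv]; rewrite /interior.
apply/uniform_nbhs; exists [set p | `|p.1 - p.2| < `|z v| - y]%R; split.
  rewrite -entourage_ballE; exists (`|z v| - y)%R => //=.
  by rewrite subr_gt0 -lte_fin.
move=> h /= /(_ v Logic.I) zh; apply/lt_supnorm; exists v => //.
rewrite lte_fin; move: zh.
have := ler_normD (z v - h v)%R (h v); rewrite subrK; lra.
Qed.

(** Open upper rays generate the Borel sets of the extended reals, and their preimages are preimages
    of open sets under [G]. *)
Lemma measurable_process_norm : tight_gaussian G ->
  measurable_fun setT (@process_norm _ _ G).
Proof.
move=> tG; apply: (measurability _ (ErealGenOInfty.measurableE R)).
move=> _ [_ [y ->] <-]; rewrite setTI.
have := tg_borel tG (open_supnorm_gt y).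
congr measurable; apply/seteqP; split=> w; rewrite /= in_itv/= andbT//.
Qed.

Lemma measurable_near_level (x e : R) : tight_gaussian G ->
  measurable [set w : process_space G | `|process_norm w - x%:E| <= e%:E].
Proof.
move=> tG; apply: measurable_sublevel; apply: measurableT_comp => //.
by apply: emeasurable_funB => //; exact: measurable_process_norm.
Qed.

Lemma le_concentration (e e' : R) : tight_gaussian G -> (e <= e')%R ->
  concentration G e <= concentration G e'.
Proof.
move=> tG ee'; apply: ge_ereal_sup => _ [x _ <-].
apply: (@le_trans _ _ (process_prob G
    [set w | `|process_norm w - x%:E| <= e'%:E])); last first.
  by apply: ereal_sup_ubound; exists x.
apply: le_measure; rewrite ?inE; [exact: measurable_near_level..|].
by move=> w /= /le_trans; apply; rewrite lee_fin.
Qed.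

Lemma concentration_ge0 e : 0 <= concentration G e.
Proof. by apply: le_trans (ereal_sup_ubound _); last (by exists 0%R). Qed.

(** A norm above [q - e] is either above [q], with probability at most [b] because the quantile is
    attained, or within [e] of [q], an event whose probability [concentration] dominates. *)
Lemma process_norm_tail (b q e : R) : tight_gaussian G ->
  quantile (process_prob G) (@process_norm _ _ G) (1 - b) = q%:E ->
  process_prob G [set w | (q - e)%:E < process_norm w] <=
  b%:E + concentration G e.
Proof.
move=> tG Eq; set Q := process_prob G.
have mN := measurable_process_norm tG.
have mtail (y : \bar R) : measurable [set w : process_space G | y < process_norm w].
  exact: measurable_superlevel.
have mconc : measurable [set w : process_space G | `|process_norm w - q%:E| <= e%:E].
  exact: measurable_near_level.
have tail : Q [set w | q%:E < process_norm w] <= b%:E.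
  have := le_prob_quantile _ _ mN _ _ Eq.
  rewrite (_ : [set w | _] = ~` [set w : process_space G | q%:E < process_norm w]).
    rewrite probability_setC//.
    rewrite -(fineK (fin_num_measure Q _ (mtail _))) -EFinB !lee_fin; lra.
  by apply/seteqP; split=> w /=; rewrite leNgt => /negP.
apply: (@le_trans _ _ (Q ([set w | q%:E < process_norm w] `|`
    [set w | `|process_norm w - q%:E| <= e%:E]))).
  apply: le_measure; rewrite ?inE//; first exact: measurableU.
  move=> w /=; case: (process_norm w) => [r| _|//]; last by left; rewrite ltry.
  rewrite -EFinB abse_EFin lte_fin !lee_fin => qr.
  have [qr'|rq] := ltP q r; [by left; rewrite lte_fin|right].
  by rewrite ler_norml; lra.
apply: le_trans (measureU2 _ _ _) _ => //; apply: leeD => //.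
by apply: ereal_sup_ubound; exists q.
Qed.

Lemma concentration_le1 (e : R) : tight_gaussian G -> concentration G e <= 1.
Proof.
move=> tG; apply: ge_ereal_sup => _ [x _ <-]; apply: probability_le1.
exact: measurable_near_level.
Qed.

End process_norm.

(** * A deterministic coverage criterion, and bounds on the Gaussian quantiles *)

Section model.
Context {R : realType} {d : nat} {M : model R d} {alpha : R}.
Hypothesis st : standing M alpha.
Variables (n : nat) (f : d.-tuple R -> R).
Hypotheses (n2 : (2 <= n)%N) (Mf : densities M f).

Lemma rootn_gt0 : 0 < rootn n :> R.
Proof. by rewrite sqrtr_gt0 ltr0n (ltn_trans _ n2). Qed.

Lemma rootlog_gt0 : 0 < rootlog n :> R.
Proof. by rewrite sqrtr_gt0 ln_gt0// ltr1n. Qed.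

(** Bias plus noise bounds the error, scaled by [rootn n], by [(a + c') * sigma], while the
    half-width on that scale is at least [(1 - e) * (chat + c') * sigma]. The bounds on [W] and on
    the ratio are uniform over [vset n], hence hold at the data-dependent [lhat]. *)
Lemma covers_of_bounds (w : omega M) (a e : R) :
  (W n f w <= a%:E)%E ->
  (supnorm (vset n)
     (fun v => sigmahat M (sample n w) v.1 v.2 / sigma n f v.1 v.2 - 1)%R
   <= e%:E)%E ->
  (Delta n f (lhat M (sample n w)) <= (cprime M n w)%:E)%E ->
  a + cprime M n w <= (1 - e) * (chat M (sample n w) alpha + cprime M n w) ->
  covers M alpha n f w.
Proof.
set s := sample n w; set l := lhat M s; set c' := cprime M n w.
move=> Wa He HD ac x Xx.
have Vxl : vset n (x, l) by split => //=; exact: (st_lhat st).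
have sg0 := st_sigma_gt0 st n2 Mf Vxl; have rn0 := rootn_gt0.
have := st_chat_ge0 st s n2.
have {Wa} := le_trans (supnorm_ub (Z n f w) _ _ Vxl) Wa.
have {He} := le_trans (supnorm_ub _ _ _ Vxl) He.
have {HD} := le_trans (ereal_sup_ubound _) HD => /(_ _ (ex_intro2 _ _ x Xx erefl)).
rewrite !lee_fin /Z /= -/s.
set mf := mean_fhat _ _ _ _; set sg := sigma _ _ _ _ in sg0 *.
set sh := sigmahat _ _ _ _; set fh := fhat _ _ _ _; set ch := chat _ _ _.
move=> HD He HW ch0.
(* The sign of [c'] comes from its dominating the nonnegative bias; it allows [sh_ge] to be
   multiplied by [ch + c']. *)
have c'0 : 0 <= c'.
  by apply: le_trans HD; rewrite divr_ge0 ?mulr_ge0// ltW.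
have sh_ge : (1 - e) * sg <= sh.
  by rewrite -ler_pdivlMr//; move: He; rewrite ler_norml; lra.
move: HD; rewrite ler_pdivrMr// => HD.
move: HW; rewrite normrM normrM (ger0_norm (ltW rn0)) normfV (gtr0_norm sg0).
rewrite ler_pdivrMr// => HW.
have key : rootn n * `|f x - fh| <= (ch + c') * sh.
  apply: (@le_trans _ _ (rootn n * `|f x - mf| + rootn n * `|fh - mf|)).
    by rewrite -mulrDr ler_pM2l// (distrC fh) ler_distD.
  apply: (@le_trans _ _ ((ch + c') * ((1 - e) * sg))).
    apply: (@le_trans _ _ ((a + c') * sg)); first by rewrite mulrDl; lra.
    by rewrite mulrA ler_pM2r// mulrC.
  by apply: ler_wpM2l => //; exact: addr_ge0.
have {}key : `|f x - fh| <= halfwidth alpha n w x.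
  by rewrite /halfwidth -/s -/l ler_pdivlMr// mulrC.
move: key; rewrite /band in_itv/= -/s -/l -/fh ler_norml; lra.
Qed.

(** The empty region is set apart because a sup norm over an empty index set is [-oo], which
    invalidates the lower bound on quantiles below. *)
Lemma covers_region0 : region M = set0 -> covers M alpha n f = setT.
Proof. by move=> X0; apply/seteqP; split=> // w _ x; rewrite X0. Qed.

Lemma measurable_sample : measurable_fun setT (@sample _ _ M n).
Proof.
apply/measurable_fun_tnthP => i.
have [mX _ _] := st_iid st Mf.
rewrite (_ : _ \o _ = obs M i); first exact: mX.
by apply/funext => w /=; rewrite tnth_mktuple.
Qed.

Lemma measurable_chat :
  measurable_fun setT (fun w : omega M => chat M (sample n w) alpha).
Proof. exact: measurableT_comp (st_chat_meas st n2) measurable_sample. Qed.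

Section gaussian.
Context {C1 : R} (C10 : 0 < C1).
Hypothesis tG : tight_gaussian (gauss M n f).
Hypothesis EG : (\int[process_prob (gauss M n f)]_y process_norm y
  <= (C1 * rootlog n)%:E)%E.
Hypothesis X0 : region M !=set0.

(** A constant sample suffices, since [lhat] maps it to a candidate parameter. A nonempty index set
    makes the sup norm nonnegative. *)
Let index : set_type (region M `*` cand M n).
Proof.
case: (cid X0) => x Xx.
pose s : n.-tuple (d.-tuple R) := [tuple x | i < n].
by exists (x, lhat M s); rewrite inE; split => //; exact: (st_lhat st).
Qed.

Lemma gauss_norm_ge0 (w : process_space (gauss M n f)) : (0 <= process_norm w)%E.
Proof. exact: process_norm_ge0 index w. Qed.

(** The upper bound is Markov's inequality applied to the mean norm, and it does not vary with [f].
    Together the two bounds make the quantile a real number. *)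
Lemma cquant_bounds {b : R} : 0 < b -> b < 1 ->
  (0 <= cquant M n f b <= (C1 * rootlog n / b)%:E)%E.
Proof.
move=> b0 b1; apply/andP; split.
  by apply: quantile_ge0; [exact: gauss_norm_ge0 | rewrite subr_gt0].
apply: quantile_markov => //.
- exact: measurable_process_norm.
- exact: gauss_norm_ge0.
- by rewrite mulr_gt0 ?rootlog_gt0.
Qed.

Lemma cquant_fin {b : R} : 0 < b -> b < 1 ->
  cquant M n f b = (fine (cquant M n f b))%:E.
Proof.
move=> b0 b1; have /andP[q0 qC] := cquant_bounds b0 b1.
by rewrite fineK// ge0_fin_numE// (le_lt_trans qC) ?ltry.
Qed.

End gaussian.

End model.

(** * The finite-sample coverage bound *)

Section coverage.
Context {R : realType} {d : nat} {M : model R d} {alpha c1 C1 : R}.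
Context {tau eps1 eps2 eps3 delta1 delta2 delta3 delta4 delta5 u : nat -> R}.
Hypotheses (alpha01 : 0 < alpha < 1) (C10 : 0 < C1).
Hypothesis st : standing M alpha.
Hypothesis H1 : condH1 M c1 C1 eps1 delta1.
Hypothesis H3 : condH3 M alpha c1 C1 tau eps2 delta2.
Hypothesis H4 : condH4 M c1 C1 eps3 delta3.
Hypothesis H5 : condH5 M c1 C1 delta4.
Hypothesis H6 : condH6 M c1 C1 delta5 u.
Variables (n : nat) (f : d.-tuple R -> R).
Hypotheses (n2 : (2 <= n)%N) (Mf : densities M f).

Let P := law M f.
Let G := gauss M n f.
Let N := @process_norm _ _ G.

(** On the enriched space [W > a + eps1 n] forces [|W - W0| > eps1 n] or [W0 > a], and [W0] has the
    law of the Gaussian norm. *)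
Lemma W_tail (a : R) :
  (P [set w | ((a + eps1 n)%:E < W n f w)%E] <=
   (delta1 n)%:E + process_prob G [set w | (a%:E < N w)%E])%E.
Proof.
have [_ _ /(_ f Mf)[_ [dT [T [Q [proj [W0 [mproj projE]]]]]]]] := H1.
move=> /(_ n n2)[mW0 W0E W0W].
have mW := st_W_meas st n2 Mf.
rewrite -projE; last exact: measurable_superlevel.
have <- : Q [set t | (a%:E < (W0 n t)%:E)%E] =
    process_prob G [set w | (a%:E < N w)%E].
  by rewrite (W0E [set y | (a%:E < y)%E])//; exact: measurable_superlevel.
have mE : measurable [set t | (a%:E < (W0 n t)%:E)%E].
  by apply: measurable_superlevel; exact/measurable_EFinP.
have mD : measurable [set t | ((eps1 n)%:E < `|W n f (proj t) - (W0 n t)%:E|)%E].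
  apply: measurable_superlevel; apply: measurableT_comp => //.
  apply: emeasurable_funB; last exact/measurable_EFinP.
  exact: measurableT_comp mW mproj.
apply: (@le_trans _ _ (Q ([set t | (eps1 n)%:E < `|W n f (proj t) - (W0 n t)%:E|]
   `|` [set t | a%:E < (W0 n t)%:E])))%E.
  apply: le_measure; rewrite ?inE//.
  - rewrite -[X in measurable X]setTI; apply: mproj => //.
    exact: measurable_superlevel.
  - exact: measurableU.
  - move=> t /=; case: (W n f (proj t)) => [r||//]; last by left; rewrite ltry.
    rewrite -EFinB abse_EFin !lte_fin => ar.
    have [aW|Wa] := ltP a (W0 n t); [by right|left].
    by apply: lt_le_trans (ler_norm _); lra.
by apply: le_trans (measureU2 _ _ _) _ => //; exact: leeD.
Qed.

Lemma coverage_ge :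
  (((1 - alpha) - (delta1 n + delta2 n + delta3 n + delta4 n + delta5 n)
      - tau n)%:E - concentration G (epsbar M alpha eps1 eps2 eps3 u n f)
   <= inner_prob P (covers M alpha n f))%E.
Proof.
have [/(_ n n2)/andP[eps1_gt0 _] /(_ n n2)/andP[delta1_gt0 _]
  /(_ f Mf)[/(_ n n2)[tG _ _ EG] _]] := H1.
have [/(_ n n2)/andP[tau_gt0 _] /(_ n n2)/andP[eps2_gt0 _]
  /(_ n n2)/andP[delta2_gt0 _] chat_ge _] := H3.
have [/(_ n n2)/andP[eps3_gt0 _] /(_ n n2)/andP[delta3_gt0 _] sig_near] := H4.
have [/(_ n n2)/andP[delta4_gt0 _] Delta_le] := H5.
have [/(_ n n2)/andP[delta5_gt0 _] /(_ n n2) u_gt0 cprime_le] := H6.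
have /andP[a0 a1] := alpha01.
set eb := epsbar _ _ _ _ _ _ _ _.
have [k k0 Ek] : exists2 k : R, 0 <= k & concentration G eb = k%:E.
  exists (fine (concentration G eb)); first exact/fine_ge0/concentration_ge0.
  rewrite fineK// ge0_fin_numE ?concentration_ge0//.
  by rewrite (le_lt_trans (concentration_le1 _ _ tG)) ?ltry.
rewrite Ek -EFinB.
have [X0|X0] := eqVneq (region M) set0.
  by rewrite (covers_region0 _ _ X0) inner_prob_setT lee_fin; lra.
have {}X0 : region M !=set0 by exact/set0P.
(* When [alpha + tau n >= 1] the left side is negative. Otherwise this level lies strictly between 0
   and 1 and its quantile is real. *)
have [at1|at1] := leP 1 (alpha + tau n).
  by apply: le_trans (inner_prob_ge0 _ _); rewrite lee_fin; lra.
have at0 : 0 < alpha + tau n by lra.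
pose qa := fine (cquant M n f alpha); pose qt := fine (cquant M n f (alpha + tau n)).
have Ea : cquant M n f alpha = qa%:E by exact: (cquant_fin st _ _ n2 C10 tG EG X0).
have Et : cquant M n f (alpha + tau n) = qt%:E.
  exact: (cquant_fin st _ _ n2 C10 tG EG X0).
have qa0 : 0 <= qa.
  by apply: fine_ge0; have /andP[] := cquant_bounds st _ _ n2 C10 tG EG X0 a0 a1.
have qta : qt <= qa.
  by rewrite -lee_fin -Ea -Et; apply: le_quantile; lra.
have Eeb : eb = eps1 n + eps2 n + eps3 n * (qa + u n * rootlog n) by [].
have mN := measurable_process_norm _ tG.
have ul0 : 0 <= u n * rootlog n by rewrite mulr_ge0 ?ltW ?rootlog_gt0.
have [e3|e3] := ltP 1 (eps3 n).
  (* then [eb >= c_n(alpha)], so [p_eb >= P(||G|| <= c_n(alpha)) >= 1 - alpha] *)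
  have ebq : qa <= eb.
    have : 0 <= (eps3 n - 1) * qa by rewrite mulr_ge0// subr_ge0 ltW.
    have : 0 <= eps3 n * (u n * rootlog n) by rewrite mulr_ge0// ltW.
    rewrite Eeb; lra.
  have : ((1 - alpha)%:E <= k%:E)%E.
    rewrite -Ek; apply: le_trans (le_prob_quantile _ _ mN _ _ Ea) _.
    apply: (@le_trans _ _ (process_prob G [set w | `|N w - qa%:E| <= eb%:E]))%E.
      apply: le_measure; rewrite ?inE.
      - exact: measurable_sublevel.
      - exact: measurable_near_level.
      - move=> w /=; have := gauss_norm_ge0 st _ _ n2 X0 w; rewrite -/N.
        case: (N w) => [r||]//; rewrite -EFinB abse_EFin !lee_fin ler_norml; lra.
    by apply: ereal_sup_ubound; exists qa.
  by rewrite lee_fin => ka; apply: le_trans (inner_prob_ge0 _ _); rewrite lee_fin; lra.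
(* The threshold of [B1] sits [eps1 n] above [qt - eb]: [W_tail] uses up this margin, then
   [process_norm_tail] applies. [B3] and [B4] may be nonmeasurable, hence [mu_ext] for the union
   bound. *)
pose B1 := [set w : omega M | ((qt - eb + eps1 n)%:E < W n f w)%E].
pose B2 := [set w : omega M | ((chat M (sample n w) alpha)%:E <
                     cquant M n f (alpha + tau n) - (eps2 n)%:E)%E].
pose B3 := [set w : omega M | ((eps3 n)%:E < supnorm (vset n)
  (fun v => sigmahat M (sample n w) v.1 v.2 / sigma n f v.1 v.2 - 1)%R)%E].
pose B4 := [set w : omega M | ((cprime M n w)%:E < Delta n f (lhat M (sample n w)))%E].
pose B5 := [set w : omega M | (u n * rootlog n < cprime M n w)%R].
have sub : ~` covers M alpha n f `<=` B1 `|` B2 `|` B3 `|` B4 `|` B5.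
  apply: subsetCl => w.
  rewrite !setCU /B1 /B2 /B3 /B4 /B5 => -[[[[]]]] /= /negP; rewrite -leNgt => hW.
  move=> /negP; rewrite -leNgt Et -EFinB lee_fin => hc.
  move=> /negP; rewrite -leNgt => hs /negP; rewrite -leNgt => hD /negP.
  rewrite -leNgt => hu; apply: (covers_of_bounds st _ _ n2 Mf _ _ _ hW hs hD).
  (* In the inequality left to prove, right side minus left side is exactly the sum of the four
     nonnegative products below; the first uses [eps3 n <= 1]. *)
  have : 0 <= (1 - eps3 n) * (chat M (sample n w) alpha - (qt - eps2 n)).
    by rewrite mulr_ge0 ?subr_ge0.
  have : 0 <= eps3 n * (u n * rootlog n - cprime M n w).
    by rewrite mulr_ge0 ?subr_ge0// ltW.
  have : 0 <= eps3 n * (qa - qt) by rewrite mulr_ge0 ?subr_ge0// ltW.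
  have : 0 <= eps3 n * eps2 n by rewrite mulr_ge0 ?ltW.
  rewrite Eeb; lra.
have PB1 : (mu_ext P B1 <= (delta1 n + alpha + tau n + k)%:E)%E.
  rewrite measurable_mu_extE; last first.
    by apply: measurable_superlevel; exact: (st_W_meas st).
  apply: le_trans (W_tail _) _.
  have -> : delta1 n + alpha + tau n + k = delta1 n + (alpha + tau n + k) by ring.
  rewrite [leRHS]EFinD (EFinD (alpha + tau n)) -Ek; apply: leeD => //.
  exact: process_norm_tail.
have PB2 : (mu_ext P B2 <= (delta2 n)%:E)%E.
  rewrite measurable_mu_extE.
    by apply: le_trans (chat_ge n n2); apply: ereal_sup_ubound; exists f.
  have := measurable_chat st _ _ n2 Mf measurableT _ (measurable_itv `]-oo, qt - eps2 n[).
  rewrite setTI; congr measurable; apply/seteqP; split=> w.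
    by rewrite /B2/= in_itv/= Et -EFinB lte_fin.
  by rewrite /B2/= in_itv/= Et -EFinB lte_fin.
have PB3 : (mu_ext P B3 <= (delta3 n)%:E)%E.
  by apply: le_trans (sig_near n n2); apply: ereal_sup_ubound; exists f.
have PB4 : (mu_ext P B4 <= (delta4 n)%:E)%E.
  by apply: le_trans (Delta_le n n2); apply: ereal_sup_ubound; exists f.
have PB5 : (mu_ext P B5 <= (delta5 n)%:E)%E.
  rewrite measurable_mu_extE.
    by apply: le_trans (cprime_le n n2); apply: ereal_sup_ubound; exists f.
  have := st_cprime_meas st n2 measurableT (measurable_itv `]u n * rootlog n, +oo[).
  rewrite setTI; congr measurable.
  by apply/seteqP; split=> w; rewrite /B5/= in_itv/= andbT.
have : (mu_ext P (~` covers M alpha n f) <= (delta1 n + alpha + tau n + k +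
    delta2 n + delta3 n + delta4 n + delta5 n)%:E)%E.
  apply: le_trans (le_mu_ext _ sub) _; rewrite 4!EFinD.
  do 4 (apply: le_trans (mu_extU2 _ _ _) _; apply: leeD => //).
move=> cov_le; rewrite /inner_prob; apply: le_trans (leeB (lexx 1%E) cov_le).
by rewrite -EFinB lee_fin; lra.
Qed.

End coverage.


(** * Powers of n against powers of log n *)

Section rates.
Context {R : realType} {c : R} (c0 : 0 < c).

Lemma cvg_natr_powRN : (n%:R : R) `^ (- c) @[n --> \oo] --> (0 : R).
Proof.
apply/cvgr0Pnorm_lt => e e0.
near=> n; rewrite ger0_norm ?powR_ge0// powRN invf_plt ?posrE ?powR_gt0//; last first.
  by rewrite ltr0n; near: n; exact: nbhs_infty_gt.
(* With [e^-1] written as a [c]-th power, [n] only has to exceed a constant. *)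
have -> : e^-1 = (e^-1 `^ c^-1) `^ c.
  by rewrite -powRrM mulVf ?gt_eqF// powRr1// invr_ge0 ltW.
apply: gt0_ltr_powR => //; rewrite ?nnegrE ?powR_ge0//.
by near: n; exact: nbhs_infty_gtr.
Unshelve. all: by end_near. Qed.

(** Half of the exponent absorbs the logarithm: the power of exponent [- c] is [h * h], and
    [ln y < y] at [y = 1/h] gives [h * ln n <= 2 / c]. *)
Lemma rootlog_rate (n : nat) : (2 <= n)%N ->
  [/\ (n%:R : R) `^ (- c) <= n%:R `^ (- (c / 2)),
      rootlog n * n%:R `^ (- c) <= (1 + 2 / c) * n%:R `^ (- (c / 2)) &
      rootlog n ^+ 2 * n%:R `^ (- c) <= (1 + 2 / c) * n%:R `^ (- (c / 2))].
Proof.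
move=> n2; set h := n%:R `^ (- (c / 2)); set L := rootlog n.
have n0 : (0 : R) < n%:R by rewrite ltr0n (ltn_trans _ n2).
have n1 : (1 : R) <= n%:R by rewrite ler1n (ltn_trans _ n2).
have h0 : 0 < h by rewrite powR_gt0.
have h1 : h <= 1.
  by rewrite -(powRr0 (n%:R : R)); apply: ler_powR => //; rewrite oppr_le0 divr_ge0 ?ltW.
have -> : n%:R `^ (- c) = h * h.
  rewrite /h -powRD; last by rewrite (gt_eqF n0) implybT.
  by rewrite -opprD -splitr.
have L0 : 0 <= L by exact: sqrtr_ge0.
have LL : L ^+ 2 = ln n%:R by rewrite sqr_sqrtr// ln_ge0.
have Lh : L ^+ 2 * h <= 2 / c.
  rewrite LL /h powRN ler_pdivrMr ?powR_gt0//.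
  have := ltW (ln_sublinear (powR_gt0 (c / 2) n0)); rewrite ln_powR => lnn.
  have -> : ln (n%:R : R) = 2 / c * (c / 2 * ln n%:R) by field; rewrite gt_eqF.
  by rewrite ler_pM2l// divr_gt0.
(* At [n = 2], [L] is below 1 and exceeds its square, hence the summand 1. *)
have L1 : L <= 1 + L ^+ 2.
  have := sqr_ge0 (L - 1); rewrite sqrrB; have := sqr_ge0 L; rewrite !expr2; lra.
have key : L * h <= 1 + 2 / c.
  apply: (@le_trans _ _ ((1 + L ^+ 2) * h)); first by rewrite ler_pM2r.
  by rewrite mulrDl mul1r lerD.
split.
- by rewrite ler_piMr// ltW.
- by rewrite mulrA ler_pM2r.
- by rewrite mulrA ler_pM2r//; apply: le_trans Lh _; rewrite lerDr.
Qed.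

End rates.

(** Eventual domination suffices because tail infima can be compared from some index on; the
    coverage bounds start at [n = 2]. *)
Lemma le_limn_einf {R : realType} (u v : (\bar R)^nat) :
  (\forall n \near \oo, (u n <= v n)%E) -> (limn_einf u <= limn_einf v)%E.
Proof.
move=> [N _ uv]; rewrite !limn_einf_lim; apply: lee_lim; [exact: is_cvg_einfs..|].
exists N => // n /= Nn; apply: le_ereal_inf_tmp => _ [k /= nk <-].
apply: le_trans (uv k (leq_trans Nn nk)).
by apply: ereal_inf_lbound; exists k.
Qed.

(** * The coverage bound made uniform in the density *)

Section coverage_rate.
Context {R : realType} {d : nat} {M : model R d} {alpha c1 C1 : R}.
Context {tau eps1 eps2 eps3 delta1 delta2 delta3 delta4 delta5 u : nat -> R}.
Hypotheses (alpha01 : 0 < alpha < 1) (C10 : 0 < C1).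
Hypothesis st : standing M alpha.
Hypothesis H1 : condH1 M c1 C1 eps1 delta1.
Hypothesis H3 : condH3 M alpha c1 C1 tau eps2 delta2.
Hypothesis H4 : condH4 M c1 C1 eps3 delta3.
Hypothesis H5 : condH5 M c1 C1 delta4.
Hypothesis H6 : condH6 M c1 C1 delta5 u.
Hypothesis rate_cond : forall n, (2 <= n)%N ->
  eps3 n * u n * rootlog n <= C1 * n%:R `^ (- c1).

Let r (n : nat) : R := n%:R `^ (- c1).

(* Markov's inequality gives [c_n(alpha) <= C1 sqrt(log n) / alpha], hence
   [epsbar n f <= eps_rate n] for every [f]. *)
Definition eps_rate (n : nat) : R :=
  3 * C1 * r n + C1 ^+ 2 / alpha * (rootlog n * r n).

(** The term [6 * C1 * r n] gathers the five deltas and [tau]. Enlarging the radius to a sequence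
    free of [f] produces the supremum of concentrations that H2(a) and H2(b) control. *)
Lemma coverage_ge_rate (n : nat) (f : d.-tuple R -> R) :
  (2 <= n)%N -> densities M f ->
  ((1 - alpha - 6 * C1 * r n)%:E -
    ereal_sup [set concentration (gauss M n g) (eps_rate n) | g in densities M]
   <= inner_prob (law M f) (covers M alpha n f))%E.
Proof.
move=> n2 Mf; have /andP[a0 a1] := alpha01.
have [/(_ n n2)/andP[eps1_gt0 eps1_le] /(_ n n2)/andP[delta1_gt0 delta1_le]
  /(_ f Mf)[/(_ n n2)[tG _ _ EG] _]] := H1.
have [/(_ n n2)/andP[tau_gt0 tau_le] /(_ n n2)/andP[eps2_gt0 eps2_le]
  /(_ n n2)/andP[delta2_gt0 delta2_le] _ _] := H3.
have [/(_ n n2)/andP[eps3_gt0 eps3_le] /(_ n n2)/andP[delta3_gt0 delta3_le] _] := H4.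
have [/(_ n n2)/andP[delta4_gt0 delta4_le] _] := H5.
have [/(_ n n2)/andP[delta5_gt0 delta5_le] _ _] := H6.
set S := ereal_sup _.
have le_S : (concentration (gauss M n f) (eps_rate n) <= S)%E.
  by apply: ereal_sup_ubound; exists f.
have [X0|X0] := eqVneq (region M) set0.
  have S0 : (0 <= S)%E by apply: le_trans le_S; exact: concentration_ge0.
  rewrite (covers_region0 _ _ X0) inner_prob_setT.
  apply: le_trans (leeB (lexx _) S0) _; rewrite sube0 lee_fin.
  have : 0 <= C1 * r n by rewrite mulr_ge0 ?powR_ge0// ltW.
  lra.
have {}X0 : region M !=set0 by exact/set0P.
apply: le_trans (coverage_ge alpha01 C10 st H1 H3 H4 H5 H6 _ _ n2 Mf).
apply: leeB; first by rewrite lee_fin /r; lra.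
apply: le_trans le_S; apply: le_concentration => //.
have /andP[_ qC] := cquant_bounds st _ _ n2 C10 tG EG X0 a0 a1.
have {qC} : fine (cquant M n f alpha) <= C1 * rootlog n / alpha.
  by rewrite -lee_fin -(cquant_fin st _ _ n2 C10 tG EG X0).
rewrite /epsbar /eps_rate; set q := fine _ => qC.
have e3q : eps3 n * q <= C1 * r n * (C1 * rootlog n / alpha).
  apply: (@le_trans _ _ (eps3 n * (C1 * rootlog n / alpha))).
    by rewrite ler_pM2l.
  apply: ler_wpM2r => //.
  by rewrite divr_ge0 ?mulr_ge0 ?sqrtr_ge0 ?ltW.
have -> : C1 ^+ 2 / alpha * (rootlog n * r n) = C1 * r n * (C1 * rootlog n / alpha).
  by ring.
(* The terms [eps1 n], [eps2 n] and [eps3 n * u n * rootlog n] are each at most [C1 * r n], whence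
   the factor 3 in [eps_rate]; [e3q] gives the other summand. *)
have := rate_cond n n2; rewrite /r in e3q *; lra.
Qed.

End coverage_rate.
Theorem theorem3p1 (R : realType) (alpha c1 C1 : R) :
  0 < alpha < 1 -> 0 < c1 -> 0 < C1 ->
  exists c C : R, [/\ 0 < c, 0 < C &
    forall (d : nat) (M : model R d)
      (tau eps1 eps2 eps3 delta1 delta2 delta3 delta4 delta5 u : nat -> R),
    standing M alpha ->
    condH1 M c1 C1 eps1 delta1 ->
    condH3 M alpha c1 C1 tau eps2 delta2 ->
    condH4 M c1 C1 eps3 delta3 ->
    condH5 M c1 C1 delta4 ->
    condH6 M c1 C1 delta5 u ->
    let delta n := delta1 n + delta2 n + delta3 n + delta4 n + delta5 n in
    let rate_cond := forall n, (2 <= n)%N ->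
      eps3 n * u n * rootlog n <= C1 * n%:R `^ (- c1) in
    [/\ forall n f, (2 <= n)%N -> densities M f ->
          (((1 - alpha) - delta n - tau n)%:E
             - concentration (gauss M n f) (epsbar M alpha eps1 eps2 eps3 u n f)
           <= inner_prob (law M f) (covers M alpha n f))%E,
        condH2a M -> rate_cond ->
          ((1 - alpha)%:E <=
           limn_einf (fun n => ereal_inf
             [set inner_prob (law M f) (covers M alpha n f)
             | f in densities M]))%E &
        condH2a M -> rate_cond -> condH2b M C1 ->
          forall n, (2 <= n)%N ->
          ((1 - alpha - C * n%:R `^ (- c))%:E <=
           ereal_inf [set inner_prob (law M f) (covers M alpha n f)
                     | f in densities M])%E]].


Proof.
move=> alpha01 c10 C10; have /andP[a0 a1] := alpha01.
(* [K] is the constant of [rootlog_rate], and [B] the one it yields for [eps_rate n * rootlog n]. *)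
pose K := 1 + 2 / c1; pose B := (3 * C1 + C1 ^+ 2 / alpha) * K.
have K0 : 0 < K by rewrite addr_gt0 ?divr_gt0.
have B0 : 0 < B.
  by rewrite mulr_gt0// addr_gt0 ?mulr_gt0 ?divr_gt0 ?exprn_gt0 ?invr_gt0.
(* Half of [c1] is lost to the logarithm; [6 * C1] pays for the deltas and [tau], and [C1 * B] for
   the concentration under H2(b). *)
exists (c1 / 2), (6 * C1 + C1 * B); split.
- by rewrite divr_gt0.
- by apply: addr_gt0; exact: mulr_gt0.
move=> d M tau eps1 eps2 eps3 delta1 delta2 delta3 delta4 delta5 u.
move=> st H1 H3 H4 H5 H6 delta rate_cond.
pose e := @eps_rate R alpha c1 C1.
pose S n := ereal_sup [set concentration (gauss M n f) (e n) | f in densities M].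
have e0 : positive e.
  move=> n n2; have n0 : (0 : R) < n%:R by rewrite ltr0n (ltn_trans _ n2).
  by rewrite /e /eps_rate ltr_pwDl ?mulr_gt0 ?powR_gt0//
    ?mulr_ge0 ?sqrtr_ge0 ?powR_ge0 ?invr_ge0 ?sqr_ge0 ?ltW.
have eL n : (2 <= n)%N -> e n * rootlog n <= B * n%:R `^ (- (c1 / 2)).
  move=> n2; have [_ L1 L2] := rootlog_rate c10 n n2.
  rewrite /e /eps_rate; move: L1 L2.
  set L := rootlog n; set r := n%:R `^ _; set h := n%:R `^ _ => L1 L2.
  have -> : (3 * C1 * r + C1 ^+ 2 / alpha * (L * r)) * L =
      3 * C1 * (L * r) + C1 ^+ 2 / alpha * (L ^+ 2 * r) by ring.
  rewrite /B -/K -(mulrA _ K) [leRHS]mulrDl; apply: lerD; apply: ler_wpM2l => //.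
  - by rewrite mulr_ge0 ?ltW.
  - by rewrite divr_ge0 ?sqr_ge0 ?ltW.
split.
- by move=> n f n2 Mf; exact: (coverage_ge alpha01 C10 st H1 H3 H4 H5 H6).
- move=> H2a rc.
  (* This is what H2(a) asks of [e]; it makes the supremum of concentrations in [v] vanish in the
     limit. *)
  have eL0 : e n * rootlog n @[n --> \oo] --> (0 : R).
    apply: (@squeeze_cvgr _ _ _ _ (cst 0) (fun n => B * n%:R `^ (- (c1 / 2)))).
    - exists 2%N => // n /= n2; rewrite eL// andbT.
      by rewrite mulr_ge0 ?sqrtr_ge0// ltW// e0.
    - exact: cvg_cst.
    - rewrite -[X in _ --> X](mulr0 B); apply: cvgM; first exact: cvg_cst.
      by apply: cvg_natr_powRN; rewrite divr_gt0.
  pose v n := ((1 - alpha - 6 * C1 * n%:R `^ (- c1))%:E - S n)%E.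
  have cv : v n @[n --> \oo] --> (1 - alpha)%:E.
    rewrite -[X in _ --> X]sube0; apply: cvgeB => //; last exact: H2a.
    apply: cvg_EFin; first exact: nearW.
    rewrite -[X in _ --> X]subr0 -(mulr0 (6 * C1)).
    apply: cvgB; first exact: cvg_cst.
    by apply: cvgM; [exact: cvg_cst | exact: cvg_natr_powRN].
  have <- : limn_einf v = (1 - alpha)%:E by have [] := cvg_limn_einf_sup cv.
  apply: le_limn_einf; exists 2%N => // n /= n2.
  apply: le_ereal_inf_tmp => _ [f Mf <-].
  exact: (coverage_ge_rate alpha01 C10 st H1 H3 H4 H5 H6 rc).
- move=> _ rc H2b n n2; apply: le_ereal_inf_tmp => _ [f Mf <-].
  apply: le_trans (coverage_ge_rate alpha01 C10 st H1 H3 H4 H5 H6 rc _ _ n2 Mf).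
  have [rh _ _] := rootlog_rate c10 n n2.
  apply: (@le_trans _ _ ((1 - alpha - 6 * C1 * n%:R `^ (- c1))%:E -
      (C1 * e n * rootlog n)%:E)%E); last first.
    by apply: leeB => //; exact: H2b.
  rewrite -EFinB lee_fin.
  have : C1 * (e n * rootlog n) <= C1 * (B * n%:R `^ (- (c1 / 2))).
    by rewrite ler_pM2l// eL.
  have : C1 * n%:R `^ (- c1) <= C1 * n%:R `^ (- (c1 / 2)) by rewrite ler_pM2l.
  lra.
Qed.
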